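(* Let $G$ be a finite group. Then $G$ has a finite-dimensional model for $\mathrm{E}_{\mathfrak P}G$ if and only if $G$ has prime power order.
   Context: $\mathfrak P$ denotes the class of finite groups of prime power order (groups of order $p^a$ for some prime $p$ and some integer $a\ge 0$; the trivial group is included). A class of groups means a collection of groups closed under isomorphism and under taking subgroups. For a class of groups $\mathcal F$ and a (discrete) group $G$, a $G$-CW-complex $X$ is said to be a model for $\mathrm{E}_{\mathcal F}G$ if, for every subgroup $H\le G$, the fixed point set $X^H$ is contractible when $H\in\mathcal F$ and is empty when $H\notin\mathcal F$. In a $G$-CW-complex the setwise stabilizer of each cell fixes the cell pointwise. *)

(* Defs.v *)
From mathcomp Require Import all_boot all_order all_algebra all_fingroup.
From mathcomp Require Import all_classical all_reals topology normedtype.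

Set Implicit Arguments.
Unset Strict Implicit.
Unset Printing Implicit Defensive.

Import Order.TTheory GRing.Theory Num.Theory.
Import numFieldNormedType.Exports.

Local Open Scope classical_set_scope.
Local Open Scope ring_scope.

(** Closure under subgroups is stated inside a fixed ambient [finGroupType];
    together with closure under isomorphism this covers all subgroups. *)
Record group_class := GroupClass {
  in_class :> forall gT : finGroupType, {group gT} -> Prop;
  group_class_isog : forall (gT hT : finGroupType)
    (G : {group gT}) (H : {group hT}),
    G \isog H -> in_class G -> in_class H;
  group_class_sub : forall (gT : finGroupType) (G H : {group gT}),
    H \subset G -> in_class G -> in_class H
}.

Definition prime_power_order (gT : finGroupType) (G : {group gT}) : Prop :=
  exists p a : nat, prime p /\ #|G| = (p ^ a)%N.

Lemma prime_power_order_isog (gT hT : finGroupType)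
    (G : {group gT}) (H : {group hT}) :
  G \isog H -> prime_power_order G -> prime_power_order H.
Proof.
by move=> /card_isog GH [p [a [pp Ga]]]; exists p, a; rewrite -GH.
Qed.

Lemma prime_power_order_sub (gT : finGroupType) (G H : {group gT}) :
  H \subset G -> prime_power_order G -> prime_power_order H.
Proof.
move=> /cardSg HG [p [a [pp Ga]]].
by move: HG; rewrite Ga => /(dvdn_pfactor _ _ pp)[b _ Hb]; exists p, b.
Qed.

Definition prime_power_class : group_class :=
  GroupClass prime_power_order_isog prime_power_order_sub.

Section Disks.
Variables (R : realType) (n : nat).
Implicit Type x : 'rV[R]_n.

(** The norm of ['rV[R]_n] is the sup norm, hence the explicit sum of squares. *)
Definition disk : set 'rV[R]_n := [set x | \sum_(i < n) x 0 i ^+ 2 <= 1].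
Definition open_disk : set 'rV[R]_n := [set x | \sum_(i < n) x 0 i ^+ 2 < 1].
Definition sphere : set 'rV[R]_n := [set x | \sum_(i < n) x 0 i ^+ 2 = 1].

End Disks.

Arguments disk : clear implicits.
Arguments open_disk : clear implicits.
Arguments sphere : clear implicits.

(** CW-complexes in the sense of Whitehead: a Hausdorff space with
    characteristic maps, only the values of which on the closed disk matter.
    By compactness of the disk, injectivity on the open disk already makes
    the characteristic map a homeomorphism onto the open cell. *)
Record cw_complex (R : realType) := CWComplex {
  cw_space :> topologicalType;
  cw_cell : Type;
  cw_dim : cw_cell -> nat;
  cw_map : forall e : cw_cell, 'rV[R]_(cw_dim e) -> cw_space;
  cw_open_cell (e : cw_cell) : set cw_space :=
    @cw_map e @` open_disk R (cw_dim e);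
  cw_hausdorff : hausdorff_space cw_space;
  cw_map_continuous : forall e,
    {within disk R (cw_dim e), continuous (@cw_map e)};
  cw_map_inj : forall e, set_inj (open_disk R (cw_dim e)) (@cw_map e);
  cw_disjoint : trivIset setT cw_open_cell;
  cw_cover : \bigcup_e cw_open_cell e = setT;
  cw_closure_finite : forall e, exists S : set cw_cell,
    [/\ finite_set S,
        forall e', S e' -> (cw_dim e' < cw_dim e)%N
      & @cw_map e @` sphere R (cw_dim e)
          `<=` \bigcup_(e' in S) cw_open_cell e'];
  cw_weak_topology : forall A : set cw_space,
    (forall e, closed (disk R (cw_dim e) `&` @cw_map e @^-1` A)) -> closed A
}.

(** [action G X] is a right action; a left action [g . x] corresponds to
    [gcw_act x g^-1], which changes neither the stabilizers nor the fixed
    points of subgroups. *)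
Record gcw_complex (R : realType) (gT : finGroupType) (G : {group gT}) :=
GCWComplex {
  gcw_cw :> cw_complex R;
  gcw_act : action G gcw_cw;
  gcw_act_continuous : forall g, g \in G -> continuous (gcw_act^~ g);
  gcw_act_cell : forall g (e : cw_cell gcw_cw), g \in G ->
    exists2 e' : cw_cell gcw_cw, cw_dim e' = cw_dim e
      & gcw_act^~ g @` cw_open_cell e = cw_open_cell e';
  gcw_act_stab : forall g (e : cw_cell gcw_cw), g \in G ->
    gcw_act^~ g @` cw_open_cell e = cw_open_cell e ->
    forall x, cw_open_cell e x -> gcw_act x g = x
}.

Definition finite_dimensional (R : realType) (X : cw_complex R) : Prop :=
  exists d : nat, forall e : cw_cell X, (cw_dim e <= d)%N.

Definition fixed_points (R : realType) (gT : finGroupType) (G : {group gT})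
    (X : gcw_complex R G) (H : {group gT}) : set X :=
  [set x | forall h, h \in H -> gcw_act X x h = x].

Arguments fixed_points {R gT G} X H _.

(** Contractibility of [A] in the subspace topology: the identity of [A] is
    homotopic, within [A], to a constant map. In particular [A] is nonempty. *)
Definition contractible (R : realType) (X : topologicalType) (A : set X) :=
  exists (x0 : X) (h : X * R -> X),
    [/\ A x0,
        {within A `*` `[0, 1], continuous h},
        forall x t, A x -> t \in `[0, 1] -> A (h (x, t)),
        forall x, A x -> h (x, 0) = x
      & forall x, A x -> h (x, 1) = x0].

(** [X] is a model for the classifying space of [G] with isotropy in [F]. *)
Definition is_model (R : realType) (F : group_class) (gT : finGroupType)
    (G : {group gT}) (X : gcw_complex R G) : Prop :=
  forall H : {group gT}, H \subset G ->
    (F gT H -> contractible R (fixed_points X H)) /\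
    (~ F gT H -> fixed_points X H = set0).

(* Main.v *)
Require Import Defs.
From mathcomp Require Import all_boot all_order all_algebra all_fingroup.
From mathcomp Require Import all_solvable zify ring.

(** If G has prime power order, a point is a model, as every subgroup of G has
    prime power order.

    Conversely, let X be a model of finite dimension. The first step is group
    theory: if the normalizer of every nontrivial p-subgroup of G is a p-group,
    for every prime p, then G has prime power order
    ([local_pgroup_prime_power]). So it suffices to exclude a nontrivial
    p-subgroup P normalized by an element g of prime order q other than p
    ([model_normalizer_pgroup]). In that case the space Y of P-fixed points is
    contractible, and g maps no cell that meets Y to itself, since the points of
    Y in such a cell would be fixed by the subgroup generated by P and g.
    It remains to see that a cyclic group of prime order cannot act freely and
    cellularly on a contractible complex of finite dimension.

    The classical reason is that the classifying space of the cyclic group of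
    order q has cohomology modulo q in arbitrarily high degrees. This is carried
    out without homology of spaces, with finite tuples of points of Y in place
    of singular simplices, in the spirit of Alexander-Spanier cohomology.
    - Each open cell of dimension i has an open collar, and collars of distinct
      cells of the same dimension are disjoint ([flows_open], [flows_uniq]).
      Labelling the collars yields, for each dimension i, a function on Y with
      values in the integers modulo q that increases by 1 under g and is locally
      constant at the points of the open i-cells ([local_labelling]).
    - Each labelling defines an invariant Bockstein cocycle of degree 2 on
      tuples, which vanishes on tuples on which the labelling is constant. The
      product of these cocycles over all dimensions therefore vanishes on all
      sufficiently small tuples ([bockstein_vanish]).
    - Contractibility of Y gives, in every degree, a chain of arbitrarily small
      tuples, such that consecutive ones are related by the differentials of
      the periodic resolution of the cyclic group ([locally_small_fill],
      [tower_exists]). On these chains the product takes the value 1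
      ([ev_bockstein]), a contradiction ([contractible_no_labelling]). *)

Set Implicit Arguments.
Unset Strict Implicit.
Unset Printing Implicit Defensive.

(** * Groups whose local subgroups are p-groups *)

Section LocalPrimePower.
Local Open Scope group_scope.
Import GroupScope.
Variables (gT : finGroupType) (G : {group gT}).
Hypothesis local_pgroup : forall (p : nat) (P : {group gT}), prime p ->
  P \subset G -> p.-group P -> P :!=: 1 -> p.-group 'N_G(P).

(** Downward induction on the order of D: if D is proper in both P and R, then
    its normalizer is a p-group meeting P and R in strictly larger subgroups,
    so the larger intersections force first the normalizer, then R, into P. *)
Lemma sylow_overgroup (p : nat) (P D R : {group gT}) : prime p ->
  p.-Sylow(G) P -> D :!=: 1 -> D \subset P ->
  R \subset G -> p.-group R -> D \subset R -> R \subset P.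
Proof.
move=> p_pr sylP; have [sPG pP _] := and3P sylP.
have [n le_n] := ubnP (#|P| - #|D|).
elim: n => // n IHn in D R le_n *.
rewrite ltnS in le_n => ntD sDP sRG pR sDR.
have step (E Q : {group gT}) : D \proper E -> E \subset P ->
    Q \subset G -> p.-group Q -> E \subset Q -> Q \subset P.
  move=> ltDE sEP sQG pQ sEQ; apply: (IHn E) => //.
    have ltc := proper_card ltDE; have leP := subset_leq_card sEP.
    apply: leq_trans le_n; rewrite ltn_sub2l //; exact: leq_trans ltc leP.
  apply: contraNneq ntD => E1; rewrite -subG1 -E1; exact: proper_sub.
have [<- // | neDR] := eqVneq (D : {set gT}) R.
have [eqDP | neDP] := eqVneq (D : {set gT}) P.
  rewrite eqDP in sDR; have [_ maxP] := maxgroupP (Hall_max sylP).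
  by rewrite (maxP R) // /psubgroup sRG pR.
have ltDP : D \proper P by rewrite properEneq neDP.
have ltDR : D \proper R by rewrite properEneq neDR.
have pD : p.-group D := pgroupS sDP pP.
have pM := local_pgroup p_pr (subset_trans sDP sPG) pD ntD.
have ltDNP := nilpotent_proper_norm (pgroup_nil pP) ltDP.
have ltDNR := nilpotent_proper_norm (pgroup_nil pR) ltDR.
have sNP : 'N_G(D) \subset P.
  apply: (step ('N_P(D))%G) => //=; rewrite ?subsetIl //.
  by rewrite setSI.
apply: (step ('N_R(D))%G) => //=; last by rewrite subsetIl.
by apply: subset_trans sNP; rewrite setSI.
Qed.

(** A nontrivial element of two conjugate Sylow subgroups generates a subgroup D
    to which the preceding lemma applies, so Sylow subgroups meet trivially;
    they are self-normalizing because their normalizers are p-groups. *)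
Lemma sylow_normedTI (p : nat) (P : {group gT}) : prime p ->
  p.-Sylow(G) P -> P :!=: 1 -> normedTI P^# G P.
Proof.
move=> p_pr sylP ntP; have [sPG pP _] := and3P sylP.
apply/normedTI_P; split; first by rewrite setD_eq0 subG1.
  by rewrite subsetI sPG normD1 normG.
move=> g Gg; rewrite conjD1g => /pred0Pn[x /andP[/setD1P[ntx Px] /setD1P[_ Pgx]]].
have sPgP : P :^ g \subset P.
  apply: (@sylow_overgroup p P <[x]> (P :^ g)%G) => //=.
  - by rewrite cycle_eq1.
  - by rewrite cycle_subG.
  - by rewrite conj_subG.
  - by rewrite pgroupJ.
  - by rewrite cycle_subG.
have Ng : g \in 'N_G(P) by rewrite !inE Gg.
have [_ maxP] := maxgroupP (Hall_max sylP).
rewrite -[P : {set gT}](maxP 'N_G(P)%G) //=.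
  by rewrite /psubgroup subsetIl (local_pgroup p_pr).
by rewrite subsetI sPG normG.
Qed.

(** Counting: the conjugates of a nontrivial Sylow subgroup P cover
    |G : P| (|P| - 1), hence at least |G| / 2, nontrivial elements. Two distinct
    primes dividing |G| would thus give |G| nontrivial elements. *)
Lemma local_pgroup_prime_power : exists p a : nat, prime p /\ #|G| = (p ^ a)%N.
Proof.
have count (a b n m : nat) : m = n.+1 -> m <= a.*2 -> m <= b.*2 ->
    a + b <= n -> False by lia.
have [G1 | ntG] := eqVneq (G : {set gT}) 1.
  by exists 2, 0; rewrite G1 cards1.
pose p := pdiv #|G|; have p_pr : prime p by rewrite pdiv_prime ?cardG_gt1.
have [pG | npG] := boolP (p.-group G).
  by have [_ _ [m Gm]] := pgroup_pdiv pG ntG; exists p, m.+1.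
move: npG; rewrite /pgroup /pnat cardG_gt0 => /allPn[q].
rewrite mem_primes cardG_gt0 inE /= => /andP[q_pr q_dv] neqp.
have [P sylP] := Sylow_exists p G; have [Q sylQ] := Sylow_exists q G.
have nt r (S : {group gT}) : prime r -> r %| #|G| -> r.-Sylow(G) S -> S :!=: 1.
  move=> r_pr r_dv sylS; rewrite -cardG_gt1 (card_Hall sylS) p_part.
  by rewrite -(expn0 r) ltn_exp2l ?prime_gt1 // logn_gt0 mem_primes r_pr cardG_gt0.
have ntP := nt p P p_pr (pdiv_dvd _) sylP; have ntQ := nt q Q q_pr q_dv sylQ.
have cardS1 (S : {group gT}) : #|S| = #|S^#|.+1.
  by rewrite (cardsD1 1 S) group1.
have half r (S : {group gT}) : prime r -> r.-Sylow(G) S -> S :!=: 1 ->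
    #|G| <= (#|class_support S^# G|).*2.
  move=> r_pr sylS ntS.
  rewrite (card_support_normedTI (sylow_normedTI r_pr sylS ntS)).
  rewrite -(Lagrange (pHall_sub sylS)) doubleMl leq_mul2r; apply/orP; right.
  have := cardG_gt1 S; rewrite ntS cardS1.
  by case: #|_| => // n _; rewrite doubleS !ltnS -addnn leq_addr.
have pclass r (S : {group gT}) x : r.-Sylow(G) S ->
    x \in class_support S^# G -> [/\ x != 1, x \in G & r.-elt x].
  move=> sylS /imset2P[y g /setD1P[nty Sy] Gg ->]; split.
  - by rewrite conjg_eq1.
  - by rewrite groupJ // (subsetP (pHall_sub sylS)).
  - by rewrite p_eltJ (mem_p_elt (pHall_pgroup sylS)).
have disj : [disjoint class_support P^# G & class_support Q^# G].
  apply/pred0P => x /=; apply/negP=> /andP[/(pclass _ _ _ sylP)[ntx _ px]].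
  case/(pclass _ _ _ sylQ)=> _ _ qx; case/eqP: ntx; apply/eqP.
  rewrite -order_eq1 (@pnat_1 p #[x]) //.
  by apply: sub_in_pnat qx => r _ /eqP ->; rewrite !inE neqp.
have sub : class_support P^# G :|: class_support Q^# G \subset G^#.
  by apply/subsetP=> x /setUP[] /pclass H;
     [have [? ? _] := H _ sylP | have [? ? _] := H _ sylQ]; apply/setD1P.
have := subset_leq_card sub; rewrite cardsU disjoint_setI0 // cards0 subn0.
by move/(count _ _ _ _ (cardS1 G) (half p P p_pr sylP ntP) (half q Q q_pr sylQ ntQ)).
Qed.
End LocalPrimePower.

(** * Tuples, chains and prisms *)

Import Order.TTheory GRing.Theory Num.Theory.
Local Open Scope ring_scope.

Section TupleChains.
Variables (F : comNzRingType) (T : eqType).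
Implicit Types (phi psi : seq T -> F) (s t : seq T).

(** The simplicial coboundary on functions of finite tuples, unfolded along the
    first vertex. The empty tuple is a simplex, so the complex is augmented. *)
Fixpoint delta phi s : F :=
  if s is x :: s' then phi s' - delta (fun t => phi (x :: t)) s' else 0.

Lemma delta_eq_in phi psi s :
    (forall t, {subset t <= s} -> phi t = psi t) -> delta phi s = delta psi s.
Proof.
elim: s => [//|x s IHs] in phi psi * => eq_s /=; congr (_ - _).
  by apply: eq_s => y ys; rewrite inE ys orbT.
apply: IHs => t ts; apply: eq_s => y; rewrite !inE => /orP[-> //|/ts ->].
by rewrite orbT.
Qed.

Lemma eq_delta phi psi : phi =1 psi -> delta phi =1 delta psi.
Proof. by move=> eq_phi s; apply: delta_eq_in. Qed.

Lemma delta0 s : delta (fun=> 0) s = 0.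
Proof. by elim: s => //= x s ->; rewrite subr0. Qed.

Lemma deltaD phi psi s :
  delta (fun t => phi t + psi t) s = delta phi s + delta psi s.
Proof.
elim: s => /= [|x s IHs] in phi psi *; first by rewrite addr0.
by rewrite IHs; ring.
Qed.

Lemma deltaZ a phi s : delta (fun t => a * phi t) s = a * delta phi s.
Proof.
elim: s => /= [|x s IHs] in phi *; first by rewrite mulr0.
by rewrite IHs; ring.
Qed.

Lemma deltaB phi psi s :
  delta (fun t => phi t - psi t) s = delta phi s - delta psi s.
Proof.
rewrite -mulN1r -deltaZ -deltaD.
by apply: eq_delta => t; rewrite mulN1r.
Qed.

Lemma delta_sum (I : Type) (r : seq I) (phi : I -> seq T -> F) s :
  delta (fun t => \sum_(i <- r) phi i t) s = \sum_(i <- r) delta (phi i) s.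
Proof.
elim: r => [|i r IHr].
  by rewrite big_nil -[RHS](delta0 s); apply: eq_delta => t; rewrite big_nil.
by rewrite big_cons -IHr -deltaD; apply: eq_delta => t; rewrite big_cons.
Qed.

Lemma delta_delta phi s : delta (delta phi) s = 0.
Proof.
by elim: s => //= x s IHs in phi *; rewrite deltaB IHs subr0 subrr.
Qed.

Lemma delta_map phi (f : T -> T) s :
  delta phi (map f s) = delta (fun t => phi (map f t)) s.
Proof. by elim: s => //= x s IHs in phi *; rewrite IHs. Qed.

(** Finite formal sums of tuples, compared only through the values that [ev]
    gives them on all cochains. Thus [ev c (delta phi) = ev z phi] for all [phi]
    says that z is the boundary of c, and lists that differ by reordering or
    cancellation represent the same chain. *)
Definition chain := seq (F * seq T).
Implicit Types (c z : chain).

Definition ev c phi : F := \sum_(p <- c) p.1 * phi p.2.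

Definition supported (S : seq T -> Prop) c := forall p, p \in c -> S p.2.

Lemma ev_eq_in (S : seq T -> Prop) c phi psi : supported S c ->
  (forall s, S s -> phi s = psi s) -> ev c phi = ev c psi.
Proof.
move=> Sc eqS; rewrite /ev !big_seq; apply: eq_bigr => p pc.
by rewrite eqS //; apply: Sc.
Qed.

Lemma eq_ev c phi psi : phi =1 psi -> ev c phi = ev c psi.
Proof. by move=> eqp; apply: eq_bigr => p _; rewrite eqp. Qed.

Lemma evB c phi psi : ev c (fun s => phi s - psi s) = ev c phi - ev c psi.
Proof. by rewrite /ev -sumrB; apply: eq_bigr => p _; rewrite mulrBr. Qed.

Lemma ev1 s phi : ev [:: (1, s)] phi = phi s.
Proof. by rewrite /ev big_seq1 mul1r. Qed.

Lemma ev_cons a s c phi : ev ((a, s) :: c) phi = a * phi s + ev c phi.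
Proof. by rewrite /ev big_cons. Qed.

Lemma ev_sum (I : Type) (r : seq I) c (phi : I -> seq T -> F) :
  ev c (fun s => \sum_(i <- r) phi i s) = \sum_(i <- r) ev c (phi i).
Proof.
by rewrite /ev exchange_big; apply: eq_bigr => p _; rewrite mulr_sumr.
Qed.

(** The linear extension of a map from tuples to chains. *)
Definition bind c (k : seq T -> chain) : chain :=
  flatten [seq [seq (p.1 * r.1, r.2) | r <- k p.2] | p <- c].

Lemma ev_bind c k phi : ev (bind c k) phi = ev c (fun s => ev (k s) phi).
Proof.
rewrite /ev big_flatten big_map; apply: eq_bigr => p _.
by rewrite big_map mulr_sumr; apply: eq_bigr => r _; rewrite mulrA.
Qed.

Lemma supported_bind (S S' : seq T -> Prop) c k : supported S c ->
  (forall s, S s -> supported S' (k s)) -> supported S' (bind c k).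
Proof.
move=> Sc kS p /flatten_mapP[r rc /mapP[r' r'k ->]] /=.
by apply: kS r'k; apply: Sc.
Qed.

(** The standard triangulation of the prism over s, with bottom [map f s] and
    top [map g s]. *)
Fixpoint prism (f g : T -> T) s : chain :=
  if s is x :: s' then
    (1, f x :: map g s) :: [seq (- p.1, f x :: p.2) | p <- prism f g s']
  else [::].

Lemma ev_prism_cons f g x s phi :
  ev (prism f g (x :: s)) phi =
  phi (f x :: g x :: map g s) - ev (prism f g s) (fun t => phi (f x :: t)).
Proof.
rewrite /= ev_cons mul1r; congr (_ + _).
by rewrite /ev big_map -sumrN; apply: eq_bigr => p _; rewrite /= mulNr.
Qed.

Lemma prism_homotopy f g s phi :
  ev (prism f g s) (delta phi) + delta (fun t => ev (prism f g t) phi) s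
  = phi (map g s) - phi (map f s).
Proof.
elim: s => [|x s IHs] in phi *; first by rewrite /ev /= big_nil addr0 subrr.
rewrite ev_prism_cons [delta phi _]/= [ev _ (fun _ => _)]evB.
rewrite [delta (fun _ => ev _ _) _]/=.
have -> : delta (fun t => ev (prism f g (x :: t)) phi) s =
   delta (fun t => phi (f x :: g x :: t)) (map g s)
   - delta (fun t => ev (prism f g t) (fun u => phi (f x :: u))) s.
  by rewrite delta_map -deltaB; apply: eq_delta => t; rewrite ev_prism_cons.
have := IHs (fun t => phi (f x :: t)); rewrite /= => IH.
rewrite -[X in _ = _ - X](subKr (phi (f x :: map g s))) -IH.
by ring.
Qed.

Lemma mem_prism f g s p : p \in prism f g s ->
  forall x, x \in p.2 -> exists2 y, y \in s & x = f y \/ x = g y.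
Proof.
elim: s => [//|y s IHs] in p * => /=; rewrite inE => /predU1P[-> x|].
  rewrite /= !inE => /predU1P[->|]; first by exists y; [rewrite mem_head|left].
  move=> /predU1P[->|]; first by exists y; [rewrite mem_head|right].
  by move=> /mapP[u us ->]; exists u; [rewrite inE us orbT|right].
move=> /mapP[r /IHs IH -> x]; rewrite inE => /predU1P[->|/IH[u us ux]].
  by exists y; [rewrite mem_head|left].
by exists u; rewrite // inE us orbT.
Qed.

(** A cycle z is filled by the cone with apex x0 over its image under the last
    map f N, minus the prisms between consecutive maps f j and f (j + 1). The
    second conclusion records which points occur, so that smallness of the
    filling can be checked vertex by vertex. *)
Lemma fill_by_homotopy (f : nat -> T -> T) (N : nat) (x0 : T) z :
    f 0 =1 id -> (forall phi, ev z (delta phi) = 0) ->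
  exists2 c : chain, forall phi, ev c (delta phi) = ev z phi
    & forall p, p \in c -> exists2 s, s \in map snd z &
        (p.2 = x0 :: map (f N) s \/
         exists2 j, (j < N)%N & forall x, x \in p.2 ->
           exists2 y, y \in s & x = f j y \/ x = f j.+1 y).
Proof.
move=> f0 cycz.
pose ps s := flatten [seq [seq (- p.1, p.2) | p <- prism (f j) (f j.+1) s]
                     | j <- iota 0 N].
pose k s : chain := (1, x0 :: map (f N) s) :: ps s.
exists (bind z k) => [phi|p].
  rewrite ev_bind.
  have evk s : ev (k s) (delta phi) =
     phi (map (f N) s) - delta (fun t => phi (x0 :: map (f N) t)) s
     - \sum_(j <- iota 0 N) ev (prism (f j) (f j.+1) s) (delta phi).
    rewrite /k ev_cons mul1r /= delta_map; congr (_ + _).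
    rewrite /ev big_flatten big_map -sumrN; apply: eq_bigr => j _.
    by rewrite big_map -sumrN; apply: eq_bigr => p _; rewrite mulNr.
  (* By the homotopy formula the sum of the prisms telescopes; what remains
     besides [phi s] are coboundaries, which vanish on the cycle z. *)
  have {}evk s : ev (k s) (delta phi) =
     phi s - (delta (fun t => phi (x0 :: map (f N) t)) s
       - \sum_(j <- iota 0 N)
           delta (fun t => ev (prism (f j) (f j.+1) t) phi) s).
    rewrite evk; have tele : \sum_(j <- iota 0 N)
       (phi (map (f j.+1) s) - phi (map (f j) s)) = phi (map (f N) s) - phi s.
      have -> : phi s = phi (map (f 0) s).
        by congr phi; rewrite (eq_map f0) map_id.
      by rewrite -[N in LHS]subn0 (telescope_sumr (fun j => phi (map (f j) s))).
    move/eqP: tele; rewrite eq_sym subr_eq => /eqP ->.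
    under eq_bigr do rewrite -prism_homotopy.
    by rewrite big_split /=; ring.
  rewrite (eq_ev _ evk) !evB ev_sum cycz big1 => [|j _]; last exact: cycz.
  by rewrite !subr0.
move=> /flatten_mapP[r rz /mapP[r' + ->]] /=; rewrite inE.
move=> /predU1P[-> /=|/flatten_mapP[j]].
  by exists r.2; [apply: map_f|left].
rewrite mem_iota add0n => /= ltjN /mapP[u uP ->] /=.
exists r.2; first exact: map_f.
by right; exists j => // x; apply: (mem_prism uP).
Qed.

End TupleChains.

(** * The periodic resolution and powers of the Bockstein class *)

Section CyclicTower.
Variables (q : nat) (T : eqType) (g : T -> T).
Hypotheses (q_pr : prime q) (gK : forall x, iter q g x = x).
Local Notation F := 'F_q.
Implicit Types (phi psi : seq T -> F) (s t : seq T) (z c : chain F T).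

(** The two operators g - 1 and 1 + g + ... + g^(q-1) of the periodic
    resolution of a cyclic group of order q, on cochains. *)
Definition dtau phi s := phi (map g s) - phi s.
Definition dnorm phi s := \sum_(0 <= j < q) phi (map (iter j g) s).
Definition periodic (n : nat) := if odd n then dnorm else dtau.

Lemma delta_periodic n phi s : delta (periodic n phi) s = periodic n (delta phi) s.
Proof.
rewrite /periodic; case: ifP => _; first by rewrite delta_sum; apply: eq_bigr => j _;
  rewrite delta_map.
by rewrite /dtau deltaB delta_map.
Qed.

Lemma map_iterS j s : map (iter j g) (map g s) = map (iter j.+1 g) s.
Proof. by rewrite -map_comp; apply: eq_map => x; rewrite /= -iterSr. Qed.

Lemma map_iterSl j s : map g (map (iter j g) s) = map (iter j.+1 g) s.
Proof. by rewrite -map_comp. Qed.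

Lemma periodic_periodic n phi s : periodic n (periodic n.+1 phi) s = 0.
Proof.
have tele : \sum_(0 <= j < q) (phi (map (iter j.+1 g) s) - phi (map (iter j g) s)) = 0.
  rewrite (telescope_sumr (fun j => phi (map (iter j g) s))) //.
  by rewrite (eq_map gK) subrr.
rewrite /periodic /=; case: (odd n) => /=; rewrite /dtau /dnorm /dtau.
  by rewrite -[RHS]tele; apply: eq_bigr => j _; rewrite map_iterSl.
by rewrite -[RHS]tele -sumrB; apply: eq_bigr => j _; rewrite map_iterS.
Qed.

(** The chains of a tower are the image of the generators of the periodic
    resolution: the boundary of the chain in degree n + 1 is the chain in degree
    n, multiplied by g - 1 or by the norm according to the parity of n. *)
Inductive tower : nat -> chain F T -> Prop :=
| tower0 x : tower 0 [:: (1, [:: x])]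
| towerS n z z' : tower n z ->
    (forall phi, ev z' (delta phi) = ev z (periodic n phi)) -> tower n.+1 z'.

Lemma tower_cycle n z phi : tower n z -> ev z (periodic n (delta phi)) = 0.
Proof.
case=> [x|m z1 z2 _ dz]; first by rewrite ev1 /periodic /dtau /= subrr.
rewrite -(eq_ev _ (delta_periodic _ _)) dz (eq_ev _ (periodic_periodic _ _)).
by rewrite /ev big1 // => p _; rewrite mulr0.
Qed.

Definition periodic_chain n z : chain F T :=
  bind z (fun s => if odd n then [seq (1, map (iter j g) s) | j <- index_iota 0 q]
                   else [:: (1, map g s); (-1, s)]).

Lemma ev_periodic_chain n z phi : ev (periodic_chain n z) phi = ev z (periodic n phi).
Proof.
rewrite ev_bind; apply: eq_ev => s; rewrite /periodic; case: ifP => _.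
  by rewrite /ev big_map; apply: eq_bigr => j _; rewrite mul1r.
by rewrite ev_cons mul1r ev_cons /ev big_nil addr0 mulN1r.
Qed.

Section Smallness.
(** [L] is a collection of admissible notions of smallness for tuples. *)
Variable L : (seq T -> Prop) -> Prop.
Hypothesis L_inv : forall Sm, L Sm ->
  L (fun s => forall j, (j < q)%N -> Sm (map (iter j g) s)).
Hypothesis L_fill : forall Sm, L Sm -> exists2 Sm', L Sm' &
  forall z, supported Sm' z -> (forall phi, ev z (delta phi) = 0) ->
  exists2 c, supported Sm c & forall phi, ev c (delta phi) = ev z phi.
Variable x0 : T.
Hypothesis L_point : forall Sm, L Sm -> Sm [:: x0].

(** A tower grows one degree at a time: the translates of a sufficiently small
    chain form a small cycle, which can be filled at the price of a weaker
    smallness. Hence, for a prescribed height and a prescribed final smallness,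
    the initial smallness is fixed by induction on the height. *)
Lemma tower_exists n Sm : L Sm -> exists2 z, tower n z & supported Sm z.
Proof.
elim: n => [|n IHn] in Sm * => LSm.
  exists [:: (1, [:: x0])]; first exact: tower0.
  by move=> p; rewrite inE => /eqP ->; apply: L_point.
have [Sm' LSm' fill] := L_fill LSm.
have [z tz sz] := IHn _ (L_inv LSm').
have [||c sc dc] := fill (periodic_chain n z).
- apply: (supported_bind sz) => s inv p; case: ifP => _.
    by case/mapP=> j; rewrite mem_index_iota => /inv js ->.
  have q1 := prime_gt1 q_pr; rewrite !inE => /orP[] /eqP -> /=.
    by have := inv 1%N q1.
  by have := inv 0%N (ltnW q1); rewrite /= map_id.
- by move=> phi; rewrite ev_periodic_chain; apply: tower_cycle.
exists c => //; apply: (towerS tz) => phi.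
by rewrite dc ev_periodic_chain.
Qed.
End Smallness.

Section Class.
Variable lam : nat -> T -> nat.
Hypothesis lam_lt : forall i x, (lam i x < q)%N.
Hypothesis lamS : forall i x, lam i (g x) = ((lam i x).+1 %% q)%N.

Lemma lam_iter i j x : lam i (iter j g x) = ((lam i x + j) %% q)%N.
Proof.
elim: j => [|j IHj]; first by rewrite addn0 modn_small.
by rewrite iterS lamS IHj -addn1 modnDml addn1 addnS.
Qed.

(** If r is the residue in [0, q) of b - a, where a and b are the labels of x and
    y, then this is (r - (b - a)) / q. Hence it is a cochain whose norm is
    b - a modulo q, and its coboundary is the invariant Bockstein cocycle of
    degree 2, since the contribution of (b - a) / q cancels in it. *)
Definition descent i x y : F := (lam i y < lam i x)%N%:R.

(** Hermite's identity. *)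
Lemma sum_divn_shift n : (\sum_(0 <= j < q) (n + j) %/ q = n)%N.
Proof.
have q_gt0 := prime_gt0 q_pr.
elim: n => [|n IHn].
  by rewrite big_nat big1 // => j /= jq; rewrite divn_small.
have := IHn; rewrite -(prednK q_gt0) big_nat_recl // big_nat_recr //=.
rewrite !prednK // addn0 addSnnS prednK // divnDr ?dvdnn // divnn q_gt0.
under [in X in _ -> X]eq_bigr do rewrite addSnnS.
by lia.
Qed.

(** Descents are counted by comparing quotients: for labels a and b in [0, q),
    the quotient by q of b + j exceeds that of a + j by the descent at j minus
    the descent of the unshifted pair. Summing over a full period leaves
    b - a modulo q. *)
Lemma descent_sum i x y : \sum_(0 <= j < q) descent i (iter j g x) (iter j g y)
  = (lam i y)%:R - (lam i x)%:R.
Proof.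
have [a_lt b_lt] := (lam_lt i x, lam_lt i y).
set a := lam i x in a_lt *; set b := lam i y in b_lt *.
suff sumE : (\sum_(0 <= j < q) ((b + j) %% q < (a + j) %% q) + a
             = q * (b < a) + b)%N.
  apply/eqP; rewrite eq_sym subr_eq; apply/eqP.
  under eq_bigr do rewrite /descent !lam_iter.
  rewrite -natr_sum -natrD sumE natrD natrM.
  by rewrite (pchar_Fp_0 q_pr) mul0r add0r.
rewrite -[in X in (_ + X)%N = _](sum_divn_shift a) -big_split /=.
rewrite -[in X in _ = (_ + X)%N](sum_divn_shift b).
rewrite -[in X in _ = (X * _ + _)%N](subn0 q) -sum_nat_const_nat -big_split /=.
apply: eq_bigr => j _.
have := divn_eq (a + j) q; have := divn_eq (b + j) q.
have := ltn_pmod (a + j) (prime_gt0 q_pr).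
have := ltn_pmod (b + j) (prime_gt0 q_pr).
move: (_ %/ _)%N (_ %% _)%N => u v; move: (_ %/ _)%N (_ %% _)%N => u' v'.
move=> *; have : (u <= u' + 1)%N by nia.
have : (u' <= u + 1)%N by nia.
by nia.
Qed.

Lemma descent_cocycle_invariant i x y (w : T) :
  descent i (g y) (g w) - descent i (g x) (g w) + descent i (g x) (g y)
  = descent i y w - descent i x w + descent i x y.
Proof.
rewrite /descent !lamS.
have modS n : (n < q)%N -> (n.+1 %% q = if n.+1 == q then 0 else n.+1)%N.
  by case: eqP => [->|]; rewrite ?modnn // => nq ltn; rewrite modn_small //; lia.
rewrite !modS //.
move: (lam_lt i x) (lam_lt i y) (lam_lt i w).
move: (lam i x) (lam i y) (lam i w) => a b c aq bq cq.
have natrE (m n k m' n' k' : nat) : (m + k + n' = m' + k' + n)%N ->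
    m%:R - n%:R + k%:R = m'%:R - n'%:R + k'%:R :> F.
  move/(congr1 (fun l => l%:R : F)); rewrite !natrD => e.
  apply/subr0_eq; move/eqP: e; rewrite -subr_eq0 => /eqP <-; ring.
apply: natrE; do 3![case: ifP => ?]; lia.
Qed.

Definition mulhead (a : T -> F) phi s := if s is x :: _ then a x * phi s else 0.

Definition cuphead (a : T -> T -> F) phi s :=
  if s is x :: s' then mulhead (a x) phi s' else 0.

Lemma delta_mulhead a phi x s : delta phi (x :: s) = 0 ->
  delta (mulhead a phi) (x :: s) = mulhead a phi s - a x * phi s.
Proof.
rewrite /= => /subr0_eq ->; congr (_ - _).
by rewrite -deltaZ.
Qed.

Definition lamr i x : F := (lam i x)%:R.

(** The cup product of the Bockstein cocycles of the labellings 0, ..., i - 1,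
    written as an iterated coboundary of the non-invariant cochains
    [cuphead (descent j) _]. The factor j vanishes wherever the labelling j is
    constant, so the product vanishes on tuples on which one of the labellings
    is constant. *)
Fixpoint bockstein (i : nat) : seq T -> F :=
  if i is j.+1 then delta (cuphead (descent j) (bockstein j)) else fun s => (size s == 1)%:R.

Arguments bockstein i s : simpl nomatch.

Lemma bockstein_nil i : bockstein i [::] = 0. Proof. by case: i. Qed.

Lemma delta_bockstein i s : delta (bockstein i) s = 0.
Proof.
case: i => [|i]; last exact: delta_delta.
case: s => [|x [|y s]] //=; first by rewrite subrr.
rewrite eqSS.
have d0 (u : seq T -> F) : u =1 (fun=> 0) -> delta u s = 0.
  by move=> u0; rewrite (eq_delta u0) delta0.
rewrite (@d0 (fun t => _)) // subr0.
by rewrite subrr.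
Qed.

(** The cochain whose coboundary is taken is not invariant under g; the
    coboundary is, because it is the cup product of the previous class with the
    invariant cocycle of [descent_cocycle_invariant]. *)
Lemma bockstein_invariant i s : bockstein i (map g s) = bockstein i s.
Proof.
elim: i => [|i IHi] in s *; first by rewrite /= size_map.
have expand x y t : bockstein i.+1 (x :: y :: t) =
    mulhead (fun w => descent i y w - descent i x w + descent i x y) (bockstein i) t.
  have := delta_mulhead (descent i x) (delta_bockstein i (y :: t)).
  move=> dE.
  transitivity (mulhead (descent i y) (bockstein i) t -
     delta (mulhead (descent i x) (bockstein i)) (y :: t)); first by [].
  rewrite dE; case: t {dE} => [|w t] /=; first by rewrite bockstein_nil; ring.
  by ring.
case: s => [|x [|y s]] //.
rewrite [map _ _]/= !expand; case: s => //= w s.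
by rewrite descent_cocycle_invariant -[_ :: map g s]/(map g (w :: s)) IHi.
Qed.

Lemma bockstein_invariant_iter i j s : bockstein i (map (iter j g) s) = bockstein i s.
Proof.
elim: j => [|j IHj]; first by rewrite map_id.
by rewrite -map_iterSl bockstein_invariant.
Qed.

Lemma bockstein_vanish i j s : (j < i)%N ->
  (forall x y, x \in s -> y \in s -> lam j x = lam j y) -> bockstein i s = 0.
Proof.
elim: i => [//|i IHi] in s *; rewrite ltnS leq_eqVlt => lt_ji eq_s.
rewrite -[RHS](delta0 F s) [LHS]/(delta (cuphead (descent i) (bockstein i)) s).
apply: delta_eq_in => -[|x [|y t]] //= ts.
move/predU1P: lt_ji => [ji | lt_ji].
  rewrite /descent -ji (eq_s x y) ?ltnn ?mul0r //; apply: ts; rewrite !inE eqxx //.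
  by rewrite orbT.
rewrite (IHi (y :: t)) ?mulr0 // => u v uS vS.
by apply: eq_s; apply: ts; rewrite inE ?uS ?vS orbT.
Qed.

(** The class of degree 2 i is nonzero on the tower. Going down two degrees,
    the coboundary of the descent cochain becomes its norm, which is the cup
    product with the difference of labels; that is in turn the coboundary of
    the cochain multiplied by the label of the first vertex, whose image under
    g - 1 is the class of degree 2 i, as labels increase by 1. *)
Lemma ev_bockstein i z : tower i.*2 z -> ev z (bockstein i) = 1.
Proof.
elim: i => [|i IHi] in z *.
  by rewrite double0 => tz; inversion tz; rewrite ev1.
rewrite doubleS => tz; inversion tz as [|n z1 z2 tz1 dz]; subst n z2.
inversion tz1 as [|n z0 z2 tz0 dz1]; subst n z2.
rewrite -(IHi _ tz0) /= dz.
have -> : ev z0 (bockstein i) = ev z0 (periodic i.*2 (mulhead (lamr i) (bockstein i))).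
  apply: eq_ev => s; rewrite /periodic odd_double /dtau.
  case: s => [|x s] /=; first by rewrite bockstein_nil subrr.
  rewrite -[_ :: map g s]/(map g (x :: s)) bockstein_invariant /lamr lamS Fp_nat_mod //.
  by rewrite mulrSr; ring.
rewrite -dz1; apply: eq_ev => s.
rewrite /periodic /= odd_double /= /dnorm.
case: s => [|x s]; first by rewrite big1.
rewrite (delta_mulhead _ (delta_bockstein i _)).
case: s => [|y s] /=; first by rewrite big1 ?bockstein_nil // mulr0 subrr.
rewrite -mulrBl -descent_sum mulr_suml; apply: eq_bigr => j _.
by rewrite -[_ :: map (iter j g) s]/(map (iter j g) (y :: s)) bockstein_invariant_iter.
Qed.

End Class.
End CyclicTower.

(** * Small chains in contractible spaces *)

From mathcomp Require Import all_classical all_reals topology normedtype realfun.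
Import numFieldNormedType.Exports.
Local Open Scope classical_set_scope.
Local Open Scope ring_scope.

Section Local.
Variables (R : realType) (X : topologicalType) (A : set X).

(** Smallness with respect to an open cover of A, without naming the cover:
    each point of A has a neighborhood all of whose tuples are small. *)
Definition locally_small (Sm : seq A -> Prop) := forall y : A,
  exists2 W : set X, nbhs (val y) W & forall s, (forall x, x \in s -> W (val x)) -> Sm s.

Lemma locally_small_point Sm : locally_small Sm -> forall y, Sm [:: y].
Proof.
move=> loc y; have [W yW sW] := loc y; apply: sW => x.
by rewrite inE => /eqP ->; apply: nbhs_singleton.
Qed.

Lemma locally_small_inv (g : A -> A) (gX : X -> X) (q : nat) Sm :
  (forall y, val (g y) = gX (val y)) -> (forall x, A x -> {for x, continuous gX}) ->
  locally_small Sm ->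
  locally_small (fun s => forall j, (j < q)%N -> Sm (map (iter j g) s)).
Proof.
move=> gE gC loc y.
have val_iter j x : val (iter j g x) = iter j gX (val x).
  by elim: j => [//|j IHj]; rewrite !iterS gE IHj.
have cont j : {for val y, continuous (iter j gX)}.
  elim: j => [|j IHj]; first exact: cvg_id.
  apply: (@continuous_comp _ _ _ (iter j gX) gX) => //.
  by apply: gC; rewrite -val_iter; apply: set_valP.
have /boolp.choice[W WP] : forall j, exists V, nbhs (iter j gX (val y)) V /\
    forall s : seq A, (forall x, x \in s -> V (val x)) -> Sm s.
  move=> j.
  by have [V yV sV] := loc (iter j g y); exists V; rewrite -val_iter.
exists (fun x => forall j, (j < q)%N -> W j (iter j gX x)).
  elim: q => [|m IHq]; first by apply: (@filterS _ (nbhs (val y)) _ _ _ _ filterT) => x _ j.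
  have Wm : nbhs (val y) (fun x => W m (iter m gX x)).
    exact: (cont m _ (proj1 (WP m))).
  apply: (@filterS _ (nbhs (val y)) _ _ _ _ (filterI IHq Wm)) => x [Wx Wq] j.
  rewrite ltnS leq_eqVlt.
  by move=> /predU1P[-> //|]; apply: Wx.
move=> s sW j jq; apply: (proj2 (WP j)) => _ /mapP[x xs ->].
by rewrite val_iter; apply: sW.
Qed.

Variables (h : X * R -> X) (x0 : X).
Hypotheses (Ax0 : A x0) (h_cont : {within A `*` `[0, 1], continuous h}).
Hypothesis h_in : forall x t, A x -> t \in `[0, 1] -> A (h (x, t)).
Hypothesis h0 : forall x, A x -> h (x, 0) = x.
Hypothesis h1 : forall x, A x -> h (x, 1) = x0.

(** A Lebesgue number for the compact time interval: near y, the homotopy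
    carries short time intervals into sets all of whose tuples are small. *)
Lemma homotopy_small Sm : locally_small Sm -> forall y : A,
  exists2 W, nbhs (val y) W & exists2 e : R, 0 < e &
    forall t, t \in `[0, 1] -> exists2 O : set X,
      (forall s : seq A, (forall x, x \in s -> O (val x)) -> Sm s) &
      forall x t', A x -> W x -> t' \in `[0, 1] -> `|t - t'| < e -> O (h (x, t')).
Proof.
move=> loc y.
have Ay : A (val y) by apply: set_valP.
pose P (i : set X * R) (t : R) := exists2 O : set X,
      (forall s : seq A, (forall x, x \in s -> O (val x)) -> Sm s) &
      forall x t', A x -> i.1 x -> t' \in `[0, 1] -> `|t - t'| < i.2 -> O (h (x, t')).
(* The covering property of [0, 1] is applied to the filter of small
   neighborhoods W of y and small positive e. *)
have /compact_near_coveringP near01 := @segment_compact R 0 1.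
have [t /= t01|[U V] [/= Usmall Vpos] UV] :=
    near01 _ (filter_prod (powerset_filter_from (nbhs (val y))) (0 : R)^'+) P _.
  have t01' : t \in `[0, 1] by rewrite inE in t01 *.
  have At := h_in Ay t01'.
  have [O Ot sO] := loc (SigSub (mem_set At)).
  have hc := iffLR (@subspace_continuousP _ _ _ h) h_cont (val y, t).
  have [[B1 B2] [/= B1y /nbhs_ballP[d d_gt0 dB2]] BO] := hc (conj Ay t01) O Ot.
  have d2 : 0 < d / 2 by rewrite divr_gt0.
  exists (ball t (d / 2), [set i : set X * R | i.1 `<=` B1 /\ 0 < i.2 < d / 2]).
    split; first by apply: nbhsx_ballx.
    exists ([set W : set X | W `<=` B1], [set e | 0 < e < d / 2]); last by move=> [].
    split => /=; first exact: small_set_sub.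
    by near=> e; apply/andP; split.
  move=> [t' [W e]] [/= tt' [WB1 /andP[e0 ed]]]; exists O => // x t'' Ax Wx t''01 tt''.
  apply: (BO (x, t'')) => /=; last by split; rewrite //= inE.
  split => /=; first exact: WB1.
  apply: dB2; rewrite /ball /= in tt' *.
  apply: (le_lt_trans (ler_distD t' _ _)).
  by rewrite [d]splitr; apply: ltrD => //; apply: lt_trans tt'' ed.
have [W [yW UW]] := filter_ex (filterI (near_small_set (nbhs_pfilter (val y))) Usmall).
have [e [e0 Ve]] := filter_ex (filterI (nbhs_right_gt (0 : R)) Vpos).
exists W => //; exists e => // t t01.
by apply: (UV (W, e)) => //=; rewrite inE in t01.
Unshelve. all: by end_near. Qed.

Definition push (t : R) (y : A) : A :=
  match pselect (A (h (val y, t))) with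
  | left p => SigSub (mem_set p)
  | right _ => y
  end.

Lemma val_push t y : t \in `[0, 1] -> val (push t y) = h (val y, t).
Proof.
move=> t01; rewrite /push; case: pselect => // nA; case: nA.
by apply: h_in => //; apply: set_valP.
Qed.

(** This plays the part of subdivision: a tuple satisfies [Sm'] if, whenever the
    time interval is cut into a sufficiently large number N of equal steps, the
    prisms swept out in each step consist of tuples that satisfy [Sm]. A cycle
    has finitely many tuples, so one N serves for all of it, and the prisms over
    the N steps, with a cone over the constant end of the homotopy, fill the
    cycle. *)
Lemma locally_small_fill (F : comNzRingType) Sm : locally_small Sm ->
  exists2 Sm', locally_small Sm' &
  forall z : chain F A, supported Sm' z -> (forall phi, ev z (delta phi) = 0) ->
  exists2 c, supported Sm c & forall phi, ev c (delta phi) = ev z phi.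
Proof.
move=> loc.
pose fine N (s : seq A) := forall j u, (j < N)%N ->
  (forall x, x \in u -> exists2 y, y \in s &
      x = push (j%:R / N%:R) y \/ x = push (j.+1%:R / N%:R) y) -> Sm u.
pose Sm' (s : seq A) := exists N0 : nat, forall N, (N0 <= N)%N -> fine N s.
have div01 j N : (j <= N)%N -> (0 < N)%N -> (j%:R / N%:R : R) \in `[0, 1].
  move=> jN N0; rewrite in_itv /= divr_ge0 //= ler_pdivrMr ?ltr0n //.
  by rewrite mul1r ler_nat.
exists Sm' => [y|z sz cycz].
  have [W yW [e e0 We]] := homotopy_small loc y.
  exists W => // s sW.
  exists (Num.truncn (e^-1)).+1 => N N0 j u jN us.
  have N_gt0 : (0 < N)%N by apply: leq_trans jN.
  have Ne : N%:R^-1 < e.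
    rewrite invf_plt ?posrE ?ltr0n //; apply: lt_le_trans (truncnS_gt _) _.
    by rewrite ler_nat.
  have [O sO WO] := We _ (div01 j N (ltnW jN) N_gt0).
  apply: sO => x /us[v vs [->|->]]; rewrite val_push ?div01 //; try exact: ltnW.
    by apply: WO; rewrite ?subrr ?normr0 ?div01 ?(ltnW jN) //; [exact: set_valP|exact: sW].
  apply: WO; rewrite ?div01 //; [exact: set_valP|exact: sW|].
  by rewrite distrC -mulrBl -natrB // subSnn mul1r ger0_norm ?invr_ge0.
have [N0 N0P] : exists N0 : nat, forall N, (N0 <= N)%N ->
    forall p, p \in z -> fine N p.2.
  elim: z sz {cycz} => [|p z IHz] sz; first by exists 0%N.
  have [|N1 N1P] := IHz; first by move=> r rz; apply: sz; rewrite inE rz orbT.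
  have [N2 N2P] := sz p (mem_head _ _).
  exists (maxn N1 N2) => N; rewrite geq_max => /andP[N1N N2N] r.
  by rewrite inE => /predU1P[->|]; [apply: N2P|apply: N1P].
have N_gt0 : (0 < N0.+1)%N by [].
pose f j := push (j%:R / N0.+1%:R).
pose y0 : A := SigSub (mem_set Ax0).
have f0 : f 0 =1 id.
  move=> y; apply: val_inj; rewrite val_push ?div01 // mul0r h0 //.
  exact: set_valP.
have f1 y : f N0.+1 y = y0.
  apply: val_inj; rewrite val_push ?div01 // divff ?pnatr_eq0 // h1 //.
  exact: set_valP.
have [c dc cs] := fill_by_homotopy N0.+1 y0 f0 cycz.
exists c => // p /cs[s /mapP[r rz ->] [->|[j jN us]]].
  have [W yW sW] := loc y0; apply: sW => x xs; suff -> : x = y0.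
    exact: nbhs_singleton.
  by move: xs; rewrite inE => /predU1P[//|/mapP[u _ ->]]; apply: f1.
exact: (N0P N0.+1 _ r rz j).
Qed.
End Local.

Section NoLabelling.
Variables (R : realType) (X : topologicalType) (A : set X).

(** An argument of cup length: the product of the d Bockstein classes is nonzero
    on a tower of height 2 d, which exists by contractibility, but vanishes on
    the chains of a tower small enough for some labelling to be constant on
    each tuple. *)
Theorem contractible_no_labelling (q d : nat) (g : A -> A) (gX : X -> X)
    (lam : nat -> A -> nat) :
  contractible R A -> prime q ->
  (forall y, val (g y) = gX (val y)) -> (forall x, A x -> {for x, continuous gX}) ->
  (forall y, iter q g y = y) ->
  (forall i y, (lam i y < q)%N) ->
  (forall i y, lam i (g y) = ((lam i y).+1 %% q)%N) ->
  (forall y : A, exists2 i, (i < d)%N & exists2 W, nbhs (val y) W &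
     forall x : A, W (val x) -> lam i x = lam i y) ->
  False.
Proof.
move=> [x0 [h [Ax0 hc h_in h0 h1]]] q_pr gE gC gK lam_lt lamS lam_loc.
pose Sm (s : seq A) := exists2 i, (i < d)%N &
  forall x y, x \in s -> y \in s -> lam i x = lam i y.
have Sm_loc : locally_small Sm.
  move=> y; have [i id [W yW cst]] := lam_loc y; exists W => // s sW.
  by exists i => // u v us vs; rewrite !cst //; apply: sW.
have [|Sm' LSm'|z tz zs] := @tower_exists q A g q_pr gK (@locally_small X A) _ _
    (SigSub (mem_set Ax0)) (fun Sm' L => locally_small_point L _) d.*2 _ Sm_loc.
- by move=> Sm' LSm'; apply: (locally_small_inv _ gE gC).
- exact: (locally_small_fill Ax0 hc h_in h0 h1).
have := ev_bockstein q_pr lam_lt lamS tz.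
rewrite (ev_eq_in zs (psi := fun=> 0)) => [|s [i id cst]].
  by rewrite /ev big1 => [/eqP|p _]; rewrite ?mulr0 // eq_sym oner_eq0.
exact: bockstein_vanish cst.
Qed.
End NoLabelling.

(** * Collars of open cells *)

Section Radial.
Variables (R : realType) (n : nat).
Implicit Types u : 'rV[R]_n.

Definition sqnorm u : R := \sum_(i < n) u 0 i ^+ 2.

Lemma sqnorm_ge0 u : 0 <= sqnorm u.
Proof. by apply: sumr_ge0 => i _; rewrite sqr_ge0. Qed.

Lemma sqnormZ (a : R) u : sqnorm (a *: u) = a ^+ 2 * sqnorm u.
Proof. by rewrite /sqnorm mulr_sumr; apply: eq_bigr => i _; rewrite mxE exprMn. Qed.

Lemma sqnorm_continuous : continuous sqnorm.
Proof.
apply: continuous_big => [|i _]; first exact: add_continuous.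
have c : continuous (fun u : 'rV[R]_n => u 0 i) by apply: coord_continuous.
by move=> u; apply: (@continuousM _ _ (fun u : 'rV[R]_n => u 0 i)); apply: c.
Qed.

Lemma closed_disk : closed (disk R n).
Proof.
rewrite (_ : disk R n = sqnorm @^-1` [set x | x <= 1]) //.
apply: preimage_closed; last exact: closed_le.
by move=> u _; apply: sqnorm_continuous.
Qed.

Lemma compact_disk : compact (disk R n).
Proof.
have box : compact [set v : 'rV[R]_n | forall i, `[(-1 : R), 1]%classic (v 0 i)].
  exact: (@rV_compact R n (fun=> `[(-1 : R), 1]%classic) (fun=> @segment_compact _ _ _)).
apply: subclosed_compact closed_disk box _.
move=> u /= u1 i; rewrite in_itv /= -ler_norml -(expr_le1 (n := 2)) // real_normK ?num_real //.
apply: le_trans u1; rewrite (bigD1 i) //= lerDl.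
by apply: sumr_ge0 => j _; rewrite sqr_ge0.
Qed.

(** The radial projection to the sphere, where the squared norm is at least 1/2;
    the maximum only makes it continuous everywhere. *)
Definition radial u : 'rV[R]_n := (Num.sqrt (Num.max (sqnorm u) 2^-1))^-1 *: u.

Lemma radial_continuous : continuous radial.
Proof.
move=> u; apply: (@continuousZ R _ _ (fun u : 'rV[R]_n => (Num.sqrt (Num.max (sqnorm u) 2^-1))^-1) id);
  last exact: cvg_id.
apply: continuousV; first by rewrite gt_eqF // sqrtr_gt0 lt_max invr_gt0 ltr0n orbT.
apply: (@continuous_comp _ _ _ (fun u => Num.max (sqnorm u) 2^-1) Num.sqrt).
  apply: (@continuous_max _ _ sqnorm (fun=> 2^-1)); first exact: sqnorm_continuous.
  by apply: (@cst_continuous _ _ (2^-1 : R^o)).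
exact: sqrt_continuous.
Qed.

Lemma radial_sphere u : 2^-1 <= sqnorm u -> sphere R n (radial u).
Proof.
move=> u2; have u0 : 0 < sqnorm u by apply: lt_le_trans u2; rewrite invr_gt0 ltr0n.
rewrite /sphere /= -/(sqnorm _) sqnormZ max_l // exprVn sqr_sqrtr ?sqnorm_ge0 //.
by rewrite mulVf // gt_eqF.
Qed.

Lemma radial_id u : sphere R n u -> radial u = u.
Proof.
rewrite /sphere /= -/(sqnorm u) => u1; rewrite /radial u1 max_l ?sqrtr1 ?invr1 ?scale1r //.
by rewrite invf_le1 ?ltr0n // ler1n.
Qed.

End Radial.

Section Cells.
Variables (R : realType) (X : cw_complex R).
Implicit Types (e : cw_cell X) (x : X).
Local Notation cell := (@cw_open_cell R X).
Local Notation "'Phi' e" := (@cw_map R X e) (at level 10, e at level 8).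

Lemma cell_inj e e' x : cell e x -> cell e' x -> e = e'.
Proof.
by move=> ex e'x; apply: (cw_disjoint (c := X)) => //; exists x.
Qed.

Lemma cell_ex x : exists e, cell e x.
Proof.
have [e _ ex] : (\bigcup_e cell e) x by rewrite cw_cover.
by exists e.
Qed.

(** The unique open cell that contains x. *)
Definition cell_of x : cw_cell X := sval (cid (cell_ex x)).

Lemma cell_ofP x : cell (cell_of x) x.
Proof. exact: (svalP (cid (cell_ex x))). Qed.

Lemma cell_ofE e x : cell e x -> cell_of x = e.
Proof. exact/cell_inj/cell_ofP. Qed.

Lemma sphere_dim e u : sphere R (cw_dim e) u ->
  (cw_dim (cell_of (Phi e u)) < cw_dim e)%N.
Proof.
move=> su; have [S [_ Sd SU]] := cw_closure_finite e.
have [|e' Se' e'u] := SU (Phi e u); first by exists u.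
by rewrite (cell_ofE e'u); apply: Sd.
Qed.

(** The points that reach the open cell e if each cell is repeatedly pushed, from
    the outer shell where the squared norm exceeds 1/2, radially to its
    boundary. These are the collar neighborhoods of the open cells. *)
Inductive flows e : X -> Prop :=
| flows_cell x : cell e x -> flows e x
| flows_step e' (u : 'rV[R]_(cw_dim e')) : sqnorm u < 1 -> 2^-1 < sqnorm u ->
    flows e (Phi e' (radial u)) -> flows e (Phi e' u).

Lemma cell_map e u : sqnorm u < 1 -> cell_of (Phi e u) = e.
Proof. by move=> u1; apply: cell_ofE; exists u. Qed.

Lemma flows_dim e x : flows e x ->
  cell_of x = e \/ (cw_dim e < cw_dim (cell_of x))%N.
Proof.
elim=> [y /cell_ofE|e' u u1 u2 _ IH]; first by left.
right; rewrite cell_map //; apply: leq_ltn_trans (sphere_dim (radial_sphere (ltW u2))).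
by case: IH => [->|/ltnW].
Qed.

Lemma flows_inv e e' (u : 'rV[R]_(cw_dim e')) : sqnorm u < 1 -> flows e (Phi e' u) ->
  e' = e \/ 2^-1 < sqnorm u /\ flows e (Phi e' (radial u)).
Proof.
move=> u1; move xE: (Phi e' u) => x fx.
case: fx xE => [y ey yE|e2 v v1 v2 fv vE].
  by left; rewrite -(cell_map u1) yE (cell_ofE ey).
right; have e2E : e2 = e' by rewrite -(cell_map v1) -vE cell_map.
subst e2; suff <- : v = u by [].
by apply: (@cw_map_inj R X e'); rewrite ?inE.
Qed.

(** A push strictly decreases the dimension of the cell, so a point cannot pass
    through two cells of the same dimension. *)
Lemma flows_uniq e e' x : cw_dim e = cw_dim e' ->
  flows e x -> flows e' x -> e = e'.
Proof.
move=> dE; elim=> [y /cell_ofE ey e'y|e1 u u1 u2 fu IH e'u].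
  by have := flows_dim e'y; rewrite ey => -[//|]; rewrite dE ltnn.
have [e1E|[_ /IH//]] := flows_inv u1 e'u.
subst e1; have := leq_trans (sphere_dim (radial_sphere (ltW u2))) (eq_leq (esym dE)).
by have [->|ltd] := flows_dim fu; rewrite ?ltnn // ltnNge ltnW.
Qed.

Lemma closed_within (T U : topologicalType) (D : set T) (f : T -> U) (K : set U) :
  closed D -> {within D, continuous f} -> closed K -> closed (D `&` f @^-1` K).
Proof.
move=> Dcl /continuous_closedP/(_ K) fcl /fcl /closed_subspaceP[V Vcl VE].
by rewrite setIC -VE; apply: closedI.
Qed.

(** By the weak topology it suffices that the complement A of the collar of e has
    closed preimage in each closed disk, which is shown by induction on the
    dimension. In the disk of e itself the preimage is the boundary sphere. In
    any other disk it consists of the inner part, where the squared norm is at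
    most 1/2, and of the radial extension of its trace on the sphere; that
    trace is closed because, by closure finiteness, the attaching map meets A in
    finitely many images of disks of smaller dimension. *)
Lemma flows_open e : open [set x | flows e x].
Proof.
rewrite -closedC; set A := ~` _; apply: cw_weak_topology => e'.
have [m] := ubnP (cw_dim e'); elim: m => // m IHm in e' *; rewrite ltnS => le_m.
have [S [Sfin Sd SU]] := cw_closure_finite e'.
pose K := \bigcup_(e2 in S) (Phi e2 @` (disk R (cw_dim e2) `&` Phi e2 @^-1` A)).
have Kcl : closed K.
  apply: (@closed_bigcup _ {classic cw_cell X}) => // e2 Se2.
  apply: compact_closed; first exact: cw_hausdorff.
  apply: continuous_compact.
    apply: continuous_subspaceW (@cw_map_continuous R X e2) => z; exact: proj1.
  apply: subclosed_compact (@compact_disk _ _) _; last by move=> z [].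
  by apply: IHm; apply: leq_trans (Sd _ Se2) le_m.
have KA u : sphere R (cw_dim e') u -> A (Phi e' u) <-> K (Phi e' u).
  move=> su; split=> [Au|[e2 Se2 [v [_ Av] <-]]//].
  have [|e2 Se2 [v v1 vE]] := SU (Phi e' u); first by exists u.
  by exists e2 => //; exists v; rewrite ?vE //; split; [exact: ltW|rewrite /= vE].
have cl_map := closed_within (@closed_disk _ _) (@cw_map_continuous R X e') Kcl.
have sphere_disk (u : 'rV[R]_(cw_dim e')) : sphere R _ u -> disk R _ u.
  by rewrite /disk /sphere /= => ->.
have diskP (u : 'rV[R]_(cw_dim e')) : disk R _ u -> sqnorm u < 1 \/ sphere R _ u.
  by rewrite /disk /= le_eqVlt => /predU1P[|]; [right|left].
have [e'E|ne] := pselect (e' = e).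
  subst e'.
  rewrite (_ : _ `&` _ = @sqnorm R (cw_dim e) @^-1` [set x | x = 1]).
    by apply: preimage_closed (@closed_eq _ _) => u _; apply: sqnorm_continuous.
  apply/seteqP; split=> [u [/diskP[u1|//] []]|u u1].
    by left; exists u.
  split; first exact: sphere_disk.
  move=> /flows_dim[cE|]; have := sphere_dim u1; first by rewrite cE ltnn.
  by move=> /ltnW; rewrite leqNgt => /negP.
rewrite (_ : _ `&` _ = (disk R (cw_dim e') `&` @sqnorm R (cw_dim e') @^-1` [set x | x <= 2^-1]) `|`
  (disk R (cw_dim e') `&` @sqnorm R (cw_dim e') @^-1` [set x | 2^-1 <= x] `&`
   @radial R (cw_dim e') @^-1` (disk R (cw_dim e') `&` Phi e' @^-1` K))).
  apply: closedU; first apply: closedI; first exact: closed_disk.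
    by apply: preimage_closed (@closed_le _ _) => u _; apply: sqnorm_continuous.
  apply: closedI; first apply: closedI; first exact: closed_disk.
    by apply: preimage_closed (@closed_ge _ _) => u _; apply: sqnorm_continuous.
  by apply: preimage_closed cl_map => u _; apply: radial_continuous.
apply/seteqP; split=> [u [Du Au]|u].
  have [u2|u2] := leP (sqnorm u) 2^-1; first by left.
  right; split; first by split=> //; apply: ltW.
  have su := radial_sphere (ltW u2); split; first exact: sphere_disk.
  apply/KA => // fu; apply: Au.
  by have [u1|/radial_id uE] := diskP u Du; [apply: flows_step|rewrite -uE].
have half_lt1 : 2^-1 < 1 :> R by rewrite invf_lt1 ?ltr0n // ltr1n.
move=> [[Du u2]|[[Du u2] [_ Ku]]]; split=> //.
  have u1 : sqnorm u < 1 by apply: le_lt_trans u2 _.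
  by move=> /(flows_inv u1)[//|[]]; rewrite ltNge u2.
have su := radial_sphere u2; move: Ku => /(KA _ su) Au fu; apply: Au.
have [u1|/radial_id -> //] := diskP u Du.
by have [//|[]] := flows_inv u1 fu.
Qed.

End Cells.

(** * Labellings of cells *)

Section Labels.
Variables (R : realType) (X : cw_complex R) (A : set X) (q : nat) (g : X -> X).
Local Notation cell := (@cw_open_cell R X).
Hypotheses (q_gt0 : (0 < q)%N) (g_cont : continuous g).
Hypothesis gK : forall x, iter q g x = x.
Hypothesis gA : forall x, A x -> A (g x).
Hypothesis g_cell : forall e, exists2 e', cw_dim e' = cw_dim e & g @` cell e = cell e'.
Hypothesis g_free : forall j x, A x -> (0 < j < q)%N -> cell_of (iter j g x) <> cell_of x.

Lemma iterA j x : A x -> A (iter j g x).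
Proof. by move=> Ax; elim: j => //= j; apply: gA. Qed.

Lemma iter_modn j x : iter (j %% q) g x = iter j g x.
Proof.
rewrite {2}(divn_eq j q); elim: (j %/ q)%N => // m IHm.
by rewrite mulSn -addnA iterD gK.
Qed.

Lemma cell_of_g x y : cell_of x = cell_of y -> cell_of (g x) = cell_of (g y).
Proof.
move=> exy; have [e' _ ge] := g_cell (cell_of x).
have im z : cell_of z = cell_of x -> cell_of (g z) = e'.
  by move=> ez; apply: cell_ofE; rewrite -ge; exists z; rewrite // -ez; apply: cell_ofP.
by rewrite !im.
Qed.

Lemma cell_of_iter j x y : cell_of x = cell_of y ->
  cell_of (iter j g x) = cell_of (iter j g y).
Proof. by move=> exy; elim: j => //= j; apply: cell_of_g. Qed.

Lemma dim_cell_of_g x : cw_dim (cell_of (g x)) = cw_dim (cell_of x).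
Proof.
have [e' <- ge] := g_cell (cell_of x); congr cw_dim.
by apply: cell_ofE; rewrite -ge; exists x => //; apply: cell_ofP.
Qed.

Lemma cell_of_iter_inj j k x : A x -> (j < q)%N -> (k < q)%N ->
  cell_of (iter j g x) = cell_of (iter k g x) -> j = k.
Proof.
wlog lt_jk : j k / (j < k)%N => [H Ax jq kq E|].
  by case: (ltngtP j k) => // lt; [|apply/esym]; apply: H.
move=> Ax jq kq E; exfalso; apply: (@g_free (k - j) (iter j g x)).
- exact: iterA.
- by apply/andP; split; lia.
by rewrite -iterD subnK // ltnW.
Qed.

(** The orbit of the cell of x is free; the label counts the steps from a chosen
    representative of this orbit to the cell of x. *)
Lemma cell_label (x0 : X) : exists mu : X -> nat, forall x, A x -> [/\ (mu x < q)%N,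
  mu (g x) = ((mu x).+1 %% q)%N &
  forall y, A y -> cell_of x = cell_of y -> mu x = mu y].
Proof.
(* The set Q x depends only on the orbit of the cell of x, hence so does the
   point chosen in it. *)
pose Q x := [set v | A v /\ exists j, cell_of (iter j g v) = cell_of x].
pose rep x := xget x0 (Q x).
have repP x : A x -> Q x (rep x).
  by move=> Ax; apply: (@xgetI _ x0 (Q x) x); split=> //; exists 0%N.
have rep_cell x y : cell_of x = cell_of y -> rep x = rep y.
  by move=> exy; rewrite /rep /Q exy.
have rep_g x : rep (g x) = rep x.
  congr (xget x0 _); apply/seteqP; split=> v [Av [j vj]]; split=> //; last first.
    by exists j.+1; apply: cell_of_g.
  exists (q.-1 + j)%N; rewrite iterD -[x in RHS]gK -(prednK q_gt0) iterSr.
  exact: cell_of_iter.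
pose L x k := A x -> (k < q)%N /\ cell_of (iter k g (rep x)) = cell_of x.
have L_uniq x y k k' : A x -> A y -> rep x = rep y -> cell_of x = cell_of y ->
    L x k -> L y k' -> k = k'.
  move=> Ax Ay rxy exy /(_ Ax)[kq kE] /(_ Ay)[kq' kE'].
  have [Ar _] := repP _ Ax; apply: (cell_of_iter_inj Ar) => //.
  by rewrite kE exy -kE' rxy.
have /boolp.choice[mu muP] : forall x, exists k, L x k.
  move=> x; have [Ax|nAx] := pselect (A x); last by exists 0%N.
  have [_ [j jE]] := repP x Ax; exists (j %% q)%N => _.
  by rewrite ltn_pmod // iter_modn.
exists mu => x Ax; split; first by case: (muP x Ax).
  apply: (L_uniq (g x) (g x)) => //; try exact: gA.
  move=> _; rewrite ltn_pmod // iter_modn; split=> //.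
  by rewrite rep_g; apply: cell_of_g; case: (muP x Ax).
by move=> y Ay exy; apply: (L_uniq x y) => //; apply: rep_cell.
Qed.

(** The i-th labelling gives all points of the collar of an i-cell the label of
    that cell. Characteristic maps need not be equivariant, and neither are the
    collars; so the collar used here is the intersection of the translated
    collars of the translated cells. Its points are described by [B]. *)
Theorem local_labelling (x0 : X) : exists lam : nat -> X -> nat,
  [/\ forall i x, A x -> (lam i x < q)%N,
      forall i x, A x -> lam i (g x) = ((lam i x).+1 %% q)%N
    & forall x, A x -> exists2 W, nbhs x W & forall y, A y -> W y ->
        lam (cw_dim (cell_of x)) y = lam (cw_dim (cell_of x)) x].
Proof.
have [mu muP] := cell_label x0.
pose B i x v := [/\ A v, cw_dim (cell_of v) = i &
  forall j, flows (cell_of (iter j g v)) (iter j g x)].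
have B_uniq i x v v' : B i x v -> B i x v' -> mu v = mu v'.
  move=> [Av vi vf] [Av' v'i vf']; have [_ _ muE] := muP v Av; apply: muE => //.
  by apply: (flows_uniq _ (vf 0%N) (vf' 0%N)); rewrite /= vi v'i.
have Bg i x v : B i x v -> B i (g x) (g v).
  move=> [Av vi vf]; split; [exact: gA|by rewrite dim_cell_of_g|].
  by move=> j; rewrite -!iterSr.
have BgV i x v : B i (g x) v -> B i x (iter q.-1 g v).
  move=> Bv; rewrite -[x]gK -{1}(prednK q_gt0) iterSr.
  by elim: q.-1 => //= n; apply: Bg.
pose L i x k := (exists2 v, B i x v & k = mu v) \/
                ((forall v, ~ B i x v) /\ k = mu x).
have L_uniq i x k k' : L i x k -> L i x k' -> k = k'.
  move=> [[v Bv ->]|[nB ->]] [[v' Bv' ->]|[nB' ->]] //.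
  - exact: B_uniq Bv Bv'.
  - by case: (nB' v).
  - by case: (nB v').
have /boolp.choice[lam lamP] : forall p : nat * X, exists k, L p.1 p.2 k.
  move=> [i x] /=; have [[v Bv]|nB] := pselect (exists v, B i x v).
    by exists (mu v); left; exists v.
  by exists (mu x); right; split=> // v Bv; apply: nB; exists v.
exists (fun i x => lam (i, x)); split=> [i x Ax|i x Ax|x Ax].
- case: (lamP (i, x)) => /= [[v [Av _ _] ->]|[_ ->]]; first by case: (muP v Av).
  by case: (muP x Ax).
- apply: (L_uniq i (g x) _ _ (lamP (i, g x))).
  case: (lamP (i, x)) => /= [[v Bv ->]|[nB ->]].
    by left; exists (g v); [exact: Bg|case: Bv => Av _ _; case: (muP v Av)].
  right; split; last by case: (muP x Ax).
  by move=> v /BgV; apply: nB.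
pose W y := forall j, (j < q)%N -> flows (cell_of (iter j g x)) (iter j g y).
have iter_cont j : continuous (iter j g).
  elim: j => [|j IHj] y; first exact: cvg_id.
  apply: (@continuous_comp _ _ _ (iter j g) g); [exact: IHj|exact: g_cont].
have WB y : W y -> B (cw_dim (cell_of x)) y x.
  by move=> Wy; split=> // j; rewrite -!(iter_modn j); apply: Wy; rewrite ltn_pmod.
exists W.
  have : forall n, nbhs x (fun y => forall j, (j < n)%N ->
      flows (cell_of (iter j g x)) (iter j g y)).
    elim=> [|n IHn].
      by apply: (@filterS _ (nbhs x) _ _ _ _ filterT) => y _ j.
    have fn : nbhs x (fun y => flows (cell_of (iter n g x)) (iter n g y)).
      apply: (iter_cont n x); apply: open_nbhs_nbhs; split; first exact: flows_open.
      by apply: flows_cell; apply: cell_ofP.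
    apply: (@filterS _ (nbhs x) _ _ _ _ (filterI IHn fn)) => y [yn yf] j.
    by rewrite ltnS leq_eqVlt => /predU1P[->//|]; apply: yn.
  by apply.
have Wx : W x by move=> j _; apply: flows_cell; apply: cell_ofP.
move=> y Ay Wy; transitivity (mu x).
  by apply: L_uniq (lamP (_, _)) _; left; exists x => //; apply: WB.
by apply/esym; apply: L_uniq (lamP (_, _)) _; left; exists x => //; apply: WB.
Qed.
End Labels.

(** * The point *)

Section PointComplex.
Variable R : realType.
Local Notation pt := 'rV[R]_0.

Lemma pt_eq (x y : pt) : x = y. Proof. by rewrite (thinmx0 x) (thinmx0 y). Qed.

Lemma pt_closed (A : set pt) : closed A.
Proof.
have [[x Ax]|nA] := pselect (exists x, A x).
  rewrite (_ : A = setT); first exact: closedT.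
  by apply/seteqP; split=> // y _; rewrite (pt_eq y x).
rewrite (_ : A = set0); first exact: closed0.
by apply/seteqP; split=> // y Ay; apply: nA; exists y.
Qed.

Lemma pt_open_disk (x : pt) : open_disk R 0 x.
Proof. by rewrite /open_disk /= big_ord0 ltr01. Qed.

(** Realized as the vector space of dimension 0, the point is its own closed and
    open disk, with the identity as characteristic map. *)
Definition point_cw : cw_complex R.
Proof.
refine (@CWComplex R pt unit (fun=> 0%N) (fun=> id) _ _ _ _ _ _ _).
- by move=> x y _; apply: pt_eq.
- by move=> _; apply: continuous_subspaceT => x; apply: cvg_id.
- by move=> _ x y _ _ _; apply: pt_eq.
- by move=> [] [].
- apply/seteqP; split=> // x _; exists tt => //.
  by exists x => //; apply: pt_open_disk.
- move=> _; exists set0; split=> // x [y +] _.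
  by rewrite /sphere /= big_ord0 => /esym/eqP; rewrite oner_eq0.
- by move=> A _; apply: pt_closed.
Defined.

Lemma point_cell (e : cw_cell point_cw) : cw_open_cell e = setT.
Proof.
apply/seteqP; split=> // x _; exists (x : pt); last by [].
exact: pt_open_disk.
Qed.

Variables (gT : finGroupType) (G : {group gT}).

Definition point_action : action G point_cw.
Proof.
by refine (@Action _ G point_cw (fun x _ => x) _); split=> // a x y.
Defined.

Definition point_gcw : gcw_complex R G.
Proof.
refine (@GCWComplex R gT G point_cw point_action _ _ _).
- by move=> g _ x; apply: cvg_id.
- by move=> g e _; exists e; rewrite // point_cell image_id.
- by [].
Defined.

Lemma point_finite_dimensional : finite_dimensional point_gcw.
Proof. by exists 0%N. Qed.

Lemma point_contractible (H : {group gT}) : contractible R (fixed_points point_gcw H).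
Proof.
exists (0 : pt), (fun x : pt * R => 0 : pt); split=> //.
- by apply: continuous_subspaceT => x; apply: cvg_cst.
- by move=> x _; apply: pt_eq.
Qed.

Lemma point_model : prime_power_order G -> is_model prime_power_class point_gcw.
Proof.
move=> ppG H sHG; split=> [_|]; first exact: point_contractible.
by case; apply: prime_power_order_sub ppG.
Qed.

End PointComplex.

(** * Isotropy of models of finite dimension *)

Section ModelIsotropy.
Variables (R : realType) (gT : finGroupType) (G : {group gT}) (X : gcw_complex R G).

Lemma gact_mul (y : X) (k l : gT) : k \in G -> l \in G ->
  gcw_act X y (k * l)%g = gcw_act X (gcw_act X y k) l.
Proof.
have [_ toM] : is_action G (gcw_act X) by case: (gcw_act X).
exact: toM.
Qed.

Lemma gact1 (y : X) : gcw_act X y 1%g = y.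
Proof.
have [inj _] : is_action G (gcw_act X) by case: (gcw_act X).
by apply: (inj 1%g); rewrite -gact_mul ?mulg1.
Qed.

Lemma iter_act (x : gT) (y : X) j : x \in G ->
  iter j (gcw_act X ^~ x) y = gcw_act X y (x ^+ j)%g.
Proof.
move=> Gx; elim: j => [|j IHj]; first by rewrite expg0 gact1.
by rewrite iterS IHj expgSr gact_mul // groupX.
Qed.

Lemma fixed_points_norm (P : {group gT}) (x : gT) (y : X) : P \subset G ->
  x \in ('N_G(P))%g -> fixed_points X P y -> fixed_points X P (gcw_act X y x).
Proof.
move=> sPG /setIP[Gx Nx] fy h Ph; have Gh := fintype.subsetP sPG h Ph.
rewrite -gact_mul // (_ : x * h = (h ^ x^-1) * x)%g; last first.
  by rewrite conjgE invgK mulgA mulgKV.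
rewrite gact_mul //; last by rewrite groupJ ?groupV.
by rewrite fy // memJ_norm ?groupV.
Qed.

Definition stabilizer (y : X) : {set gT} := [set k in G | `[< gcw_act X y k = y >]].

Lemma stabilizer_group_set y : group_set (stabilizer y).
Proof.
apply/group_setP; split=> [|k l]; first by rewrite inE group1; apply/asboolP/gact1.
rewrite !inE => /andP[Gk /asboolP yk] /andP[Gl /asboolP yl].
by rewrite groupM //; apply/asboolP; rewrite gact_mul // yk.
Qed.

Canonical stabilizer_group y := Group (stabilizer_group_set y).

Lemma stabilizer_in_class (F : group_class) y : is_model F X -> F gT (stabilizer_group y).
Proof.
move=> model; have [|_ empty] := model (stabilizer_group y).
  by apply/fintype.subsetP => k; rewrite inE => /andP[].
apply: contrapT => /empty fix0.
have : fixed_points X (stabilizer_group y) y.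
  by move=> k; rewrite inE => /andP[_ /asboolP].
by rewrite fix0.
Qed.

Hypothesis finX : finite_dimensional X.
Hypothesis modelX : is_model prime_power_class X.

(** Otherwise the normalizer of P contains an element x of prime order q other
    than p. It acts on the contractible space of P-fixed points, and a cell
    fixed by a nontrivial power of x would consist of points whose isotropy
    group contains P and x, hence has order divisible by both p and q. So x
    permutes freely the cells that meet the P-fixed points, which yields
    labellings, one for each dimension, contradicting contractibility. *)
Lemma model_normalizer_pgroup (p : nat) (P : {group gT}) : prime p ->
  P \subset G -> (p.-group P)%g -> P :!=: 1%g -> (p.-group ('N_G(P)))%g.
Proof.
move=> p_pr sPG pP ntP; apply: contrapT => /negP.
rewrite /pgroup /pnat cardG_gt0 => /allPn[q].
rewrite mem_primes cardG_gt0 inE /= => /andP[q_pr q_dv] neqp.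
have [x Nx xq] := Cauchy q_pr q_dv; have Gx : x \in G by case/setIP: Nx.
pose A := fixed_points X P; pose g (y : X) := gcw_act X y x.
have [_ p_dv_P _] := pgroup_pdiv pP ntP.
have Acontr : contractible R A.
  by have [contr _] := modelX sPG; apply: contr; exists p, (logn p #|P|);
    split=> //; apply: card_pgroup.
have gK y : iter q g y = y by rewrite iter_act // -xq expg_order gact1.
have gA y : A y -> A (g y) by apply: fixed_points_norm.
have g_cell e : exists2 e' : cw_cell X, cw_dim e' = cw_dim e &
    g @` cw_open_cell e = cw_open_cell e' by apply: gcw_act_cell.
have g_free j y : A y -> (0 < j < q)%N -> cell_of (iter j g y) <> cell_of y.
  move=> Ay /andP[j0 jq]; rewrite iter_act // => cE.
  have Gxj : (x ^+ j)%g \in G by rewrite groupX.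
  have yfix : gcw_act X y (x ^+ j)%g = y.
    apply: (gcw_act_stab Gxj _ (cell_ofP y)).
    have [e' _ im] := gcw_act_cell (cell_of y) Gxj.
    rewrite im; congr cw_open_cell; rewrite -cE; apply/esym/cell_ofE.
    by rewrite -im; exists y => //; apply: cell_ofP.
  have Kxj : (x ^+ j)%g \in stabilizer_group y by rewrite inE Gxj; apply/asboolP.
  have Kx : x \in stabilizer_group y.
    rewrite -cycle_subG; have -> : <[x]>%g = <[(x ^+ j)%g]>%g.
      apply/eqP; rewrite -/(generator _ _) generator_coprime xq prime_coprime //.
      by rewrite gtnNdvd.
    by rewrite cycle_subG.
  have sPK : P \subset stabilizer_group y.
    apply/fintype.subsetP=> k Pk; rewrite inE (fintype.subsetP sPG) //=.
    by apply/asboolP; apply: Ay.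
  have [r [a [r_pr Ka]]] := stabilizer_in_class y modelX.
  have pdv s : prime s -> (s %| #|stabilizer_group y|)%N -> s = r.
    move=> s_pr; rewrite Ka Euclid_dvdX // => /andP[+ _].
    by rewrite dvdn_prime2 // => /eqP.
  have qr : q = r by apply: pdv => //; rewrite -xq; apply: order_dvdG.
  have pr : p = r by apply: pdv => //; apply: dvdn_trans p_dv_P (cardSg sPK).
  by case/eqP: neqp; rewrite qr pr.
have [x0 _] := Acontr.
have [lam [lam_lt lamS lam_loc]] :=
  local_labelling (prime_gt0 q_pr) (gcw_act_continuous Gx) gK gA g_cell g_free x0.
have [d dimX] := finX.
pose gS (y : A) : A := SigSub (mem_set (gA _ (set_valP y))).
apply: (@contractible_no_labelling R X A q d.+1 gS g (fun i y => lam i (val y))) => //.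
- by move=> z _; apply: gcw_act_continuous.
- move=> y; apply: val_inj.
  have val_iter j : val (iter j gS y) = iter j g (val y).
    by elim: j => [//|j IHj]; rewrite !iterS -IHj.
  by rewrite val_iter gK.
- by move=> i y; apply: lam_lt; apply: set_valP.
- by move=> i y; apply: lamS; apply: set_valP.
move=> y; exists (cw_dim (cell_of (val y))); first by rewrite ltnS; apply: dimX.
have [W yW cst] := lam_loc (val y) (set_valP y); exists W => // u Wu.
by apply: cst => //; apply: set_valP.
Qed.

End ModelIsotropy.

Theorem theorem2p1 (R : realType) (gT : finGroupType) (G : {group gT}) :
  (exists X : gcw_complex R G,
     finite_dimensional X /\ is_model prime_power_class X) <->
  prime_power_order G.
Proof.
split=> [[X [finX modelX]]|ppG].
  exact: local_pgroup_prime_power (model_normalizer_pgroup finX modelX).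
exists (point_gcw R G); split; first exact: point_finite_dimensional.
exact: point_model.
Qed.
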